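(* Let $\gamma:I\to M^3$ be an arc length parametrized Frenet curve in a connected orientable Riemannian $3$-manifold, with Frenet frame $\{T,N,B\}$, curvature $\kappa$ and torsion $\tau$, and let $\mathcal V$ be a concircular vector field along $\gamma$ with potential function $f$, not parallel along $\gamma$. Then $\gamma$ is a PA curve with $(\mathcal V,\theta)$, where $\cos\theta\neq0$, if and only if $$\mathcal V=\cos\theta\,N+\sin\theta\,B$$ and $$\kappa=-\frac{1}{\cos\theta}\,f,\qquad \tau=-\theta'.$$
   Context: $\nabla$ is the Levi-Civita connection, $I\subset\mathbb R$ is an interval, and $'$ is differentiation with respect to arc length. Frenet curve in $M^3$: a smooth curve with $\gamma',\nabla_{\gamma'}\gamma',\nabla_{\gamma'}^2\gamma'$ linearly independent along $I$. When parametrized by arc length it has a positively oriented orthonormal Frenet frame $\{T=\gamma',N,B\}$ and curvatures $\kappa=\kappa_1>0$, $\tau=\kappa_2>0$ with $\nabla_TT=\kappa N$, $\nabla_TN=-\kappa T+\tau B$, $\nabla_TB=-\tau N$. Concircular along $\gamma$: a vector field $\mathcal V$ along $\gamma$ is concircular along $\gamma$ with potential function $f:I\to\mathbb R$ (smooth) if $\nabla_T\mathcal V=fT$. Parallel along $\gamma$ means $\nabla_T\mathcal V=0$ identically. PA (prescribed angle) curve: for a nowhere zero vector field $\mathcal V$ along $\gamma$ and a smooth function $\theta:I\to[0,\pi]$, $\gamma$ is a PA curve with $(\mathcal V,\theta)$ if $\mathcal V$ has unit length along $\gamma$ and $\theta$ is the angle between $\mathcal V$ and the principal normal $N$, i.e.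 $\cos\theta=\langle\mathcal V,N\rangle$.
   Formalization: Since an angle θ in [0,π] with N does not determine the sign of the B-component of V, the formulas for V, κ and τ are stated for a signed angle φ equal to θ on all of I or to −θ on all of I, instead of θ itself. *)

(* Defs.v *)
From HB Require Import structures.
From mathcomp Require Import all_boot all_order all_algebra.
From mathcomp Require Import all_classical all_reals all_analysis.

Set Implicit Arguments.
Unset Strict Implicit.
Unset Printing Implicit Defensive.

Import Order.TTheory GRing.Theory Num.Theory.
Import numFieldNormedType.Exports.

Local Open Scope classical_set_scope.
Local Open Scope ring_scope.

(* The spaces below are finite dimensional, so for open [U] this is the usual
   C^k; it is only used for open [U]. *)
Fixpoint Ck (R : realType) (E F : normedModType R) (k : nat) (U : set E)
    (f : E -> F) : Prop :=
  match k with
  | 0 => forall x, U x -> {for x, continuous f}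
  | k'.+1 => (forall x, U x -> differentiable f x) /\
             (forall v, Ck k' U (fun x => 'D_v f x))
  end.

(* Smoothness on a set that need not be open (e.g. an interval containing an
   endpoint): a total function stands for a smooth extension of its restriction
   to an open neighbourhood of the set; its values elsewhere are irrelevant. In
   particular the derivative of [f] at a point of a nondegenerate interval only
   depends on the restriction of [f] to that interval. *)
Definition smooth_on (R : realType) (E F : normedModType R) (A : set E)
    (f : E -> F) : Prop :=
  exists U : set E, [/\ open U, A `<=` U & forall k, Ck k U f].

Record chart (R : realType) (M : topologicalType) := Chart {
  dom : set M;
  coords : M -> 'rV[R]_3;
  coords_inv : 'rV[R]_3 -> M;
  dom_open : open dom;
  codom_open : open (coords @` dom);
  coords_cont : forall p, dom p -> {for p, continuous coords};
  coords_inv_cont :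
    forall x, (coords @` dom) x -> {for x, continuous coords_inv};
  coordsK : forall p, dom p -> coords_inv (coords p) = p
}.

(* The atlas need not be maximal. *)
Record manifold3 (R : realType) := Manifold3 {
  points :> topologicalType;
  points_hausdorff : hausdorff_space points;
  points_second_countable : @second_countable points;
  cidx : Type;
  atlas : cidx -> chart R points;
  atlas_cover : forall p, exists i, dom (atlas i) p;
  atlas_compat : forall i j,
    smooth_on (coords (atlas i) @` (dom (atlas i) `&` dom (atlas j)))
              (coords (atlas j) \o coords_inv (atlas i))
}.

Section Manifold.
Variables (R : realType) (M : manifold3 R).
Implicit Types (i j : cidx M) (p : M).

Definition mdom i : set M := dom (atlas i).
Definition crd i : M -> 'rV[R]_3 := coords (atlas i).

(* Tangent vectors are represented by the row vectors of their components in
   the charts; components [v] in chart [i] become [v *m transition_jac i j p] in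
   chart [j]. *)
Definition transition_jac i j p : 'M[R]_3 :=
  jacobian (crd j \o coords_inv (atlas i)) (crd i p).

Record riemannian_metric := RiemannianMetric {
  gram : cidx M -> 'rV[R]_3 -> 'M[R]_3;
  gram_smooth : forall i, smooth_on (crd i @` mdom i) (gram i);
  gram_sym : forall i x, (crd i @` mdom i) x -> (gram i x)^T = gram i x;
  gram_pos : forall i x (v : 'rV[R]_3), (crd i @` mdom i) x -> v != 0 ->
    0 < (v *m gram i x *m v^T) 0 0;
  gram_transition : forall i j p, mdom i p -> mdom j p ->
    gram i (crd i p) =
    transition_jac i j p *m gram j (crd j p) *m (transition_jac i j p)^T
}.

(* [osign i p] is 1 if the coordinate frame of chart [i] at [p] is positively
   oriented and -1 otherwise. [M] is orientable iff [orientation] is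
   inhabited. *)
Record orientation := Orientation {
  osign : cidx M -> M -> R;
  osign1 : forall i p, mdom i p -> osign i p = 1 \/ osign i p = - 1;
  osign_locally_constant : forall i p, mdom i p ->
    \forall q \near p, osign i q = osign i p;
  osign_transition : forall i j p, mdom i p -> mdom j p ->
    0 < osign i p * osign j p * \det (transition_jac i j p)
}.

Definition frame_mx (u v w : 'rV[R]_3) : 'M[R]_3 := col_mx u (col_mx v w).

(* The Christoffel symbol $\Gamma^k_{ab}$ of the Levi-Civita connection, in
   chart [i]. *)
Definition christoffel (g : riemannian_metric) i (x : 'rV[R]_3)
    (k a b : 'I_3) : R :=
  2^-1 * \sum_(l < 3) invmx (gram g i x) k l *
    ('D_(delta_mx 0 a) (fun y => gram g i y l b) x
     + 'D_(delta_mx 0 b) (fun y => gram g i y l a) x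
     - 'D_(delta_mx 0 l) (fun y => gram g i y a b) x).

(* [gamma] is a total function of which only the germ along [I] matters, as in
   [smooth_on]. *)
Definition smooth_curve (I : set R) (gamma : R -> M) : Prop :=
  (forall t, I t -> {for t, continuous gamma}) /\
  (forall i, smooth_on (I `&` gamma @^-1` mdom i) (crd i \o gamma)).

Section Curve.
Variables (g : riemannian_metric) (o : orientation).
Variables (I : set R) (gamma : R -> M).

(* Component functions of a vector field along [gamma]: [X i t] is meaningful
   when [gamma t] is in the domain of chart [i]. *)
Definition vfield := cidx M -> R -> 'rV[R]_3.

Implicit Types (X Y : vfield).

Definition vector_field_along X : Prop :=
  (forall i, smooth_on (I `&` gamma @^-1` mdom i) (X i)) /\
  (forall i j t, I t -> mdom i (gamma t) -> mdom j (gamma t) ->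
     X j t = X i t *m transition_jac i j (gamma t)).

(* [P i t] for all parameters [t] in [I] and all charts [i] around [gamma t]. *)
Definition along (P : cidx M -> R -> Prop) : Prop :=
  forall t, I t -> forall i, mdom i (gamma t) -> P i t.

Definition inner X Y i t : R :=
  (X i t *m gram g i (crd i (gamma t)) *m (Y i t)^T) 0 0.

Definition velocity : vfield := fun i => derive1 (crd i \o gamma).

(* The covariant derivative of [X] along [gamma]. *)
Definition nabla X : vfield := fun i t =>
  derive1 (X i) t + \row_k \sum_(a < 3) \sum_(b < 3)
    christoffel g i (crd i (gamma t)) k a b * velocity i t 0 a * X i t 0 b.

Definition frenet_curve : Prop :=
  smooth_curve I gamma /\
  along (fun i t => row_free
    (frame_mx (velocity i t) (nabla velocity i t) (nabla (nabla velocity) i t))).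

Definition arc_length : Prop :=
  along (fun i t => inner velocity velocity i t = 1).

Definition orthonormal_frame X Y Z : Prop :=
  along (fun i t =>
    [/\ inner X X i t = 1, inner Y Y i t = 1 & inner Z Z i t = 1] /\
    [/\ inner X Y i t = 0, inner X Z i t = 0 & inner Y Z i t = 0]).

Definition positive_frame X Y Z : Prop :=
  along (fun i t =>
    0 < osign o i (gamma t) * \det (frame_mx (X i t) (Y i t) (Z i t))).

(* The Frenet frame is (velocity, N, B). *)
Definition frenet_frame (N B : vfield) (kappa tau : R -> R) : Prop :=
  [/\ vector_field_along N /\ vector_field_along B,
      smooth_on I kappa /\ smooth_on I tau,
      forall t, I t -> 0 < kappa t /\ 0 < tau t,
      orthonormal_frame velocity N B /\ positive_frame velocity N B
    & along (fun i t =>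
        [/\ nabla velocity i t = kappa t *: N i t,
            nabla N i t = - kappa t *: velocity i t + tau t *: B i t
          & nabla B i t = - tau t *: N i t])].

Definition concircular_along X (f : R -> R) : Prop :=
  along (fun i t => nabla X i t = f t *: velocity i t).

Definition parallel_along X : Prop := along (fun i t => nabla X i t = 0).

Definition PA_curve (N X : vfield) (theta : R -> R) : Prop :=
  along (fun i t => [/\ X i t != 0, inner X X i t = 1
                      & cos (theta t) = inner X N i t]).

End Curve.
End Manifold.

(* Main.v *)
Require Import Defs.
From mathcomp Require Import all_boot all_order all_algebra.
From mathcomp Require Import all_classical all_reals all_analysis.
From mathcomp Require Import ring.

Import Order.TTheory GRing.Theory Num.Theory.
Import numFieldNormedType.Exports.

Local Open Scope classical_set_scope.
Local Open Scope ring_scope.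

(** Write V = a T + c N + b B with a = <V, T>, c = <V, N>, b = <V, B>. The
    connection is metric ([is_derive_inner]), so the Frenet equations and
    nabla_T V = f T give

      a' = f + kappa c,   b' = - tau c,   <V, V>' = 2 f a.

    Suppose that V has unit length and c = cos theta vanishes nowhere. Then
    f a = 0. Where f is nonzero, a vanishes nearby, hence a' = 0 and
    f = - kappa c. So - f / (kappa c), which is continuous, takes only the
    values 0 and 1, and it is constant on the interval I. As V is not parallel,
    f is somewhere nonzero, hence everywhere ([potential_neq0]). This gives
    a = 0 and the formula for kappa.

    What remains is c ^ 2 + b ^ 2 = 1, that is |b| = sin theta. The sign of b is
    the same along I: at an interior zero of b, the nonnegative function
    sin theta has a minimum, so its derivative is zero there, hence so is that
    of b, which has the same absolute value; but b' = - tau c is nonzero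
    ([binormal_component_interior_neq0]). Therefore b = sin phi with phi = theta
    or phi = - theta throughout, and comparing b' = - tau cos phi with
    (sin phi)' = phi' cos phi yields tau = - phi'.

    Conversely, the decomposition of V gives <V, V> = 1 and
    <V, N> = cos phi = cos theta, and cos theta cannot vanish because kappa would
    be zero there.

    An interval may contain its endpoints, and identities that hold on I only
    do not control two-sided derivatives a priori; [within_derive_unique] shows
    that they nevertheless determine the derivatives of differentiable
    extensions. *)

(** * Calculus on intervals *)

Lemma smooth_on_differentiable {R : realType} {E F : normedModType R}
    {A : set E} {f : E -> F} {x : E} :
  smooth_on A f -> A x -> differentiable f x.
Proof. by move=> [U [_ AU fU]] Ax; have [df _] := fU 1; exact/df/AU. Qed.

Lemma smooth_on_continuous {R : realType} {E F : normedModType R}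
    {A : set E} {f : E -> F} {x : E} :
  smooth_on A f -> A x -> {for x, continuous f}.
Proof.
by move=> fs Ax; exact/differentiable_continuous/(smooth_on_differentiable fs).
Qed.

Lemma smooth_on_derive1 {R : realType} {F : normedModType R}
    {A : set R} {f : R -> F} {t : R} :
  smooth_on A f -> A t -> differentiable (derive1 f) t.
Proof.
move=> [U [_ AU fU]] At; have [_ /(_ 1)[df _]] := fU 2.
have -> : derive1 f = 'D_1 f by apply/funext => s; rewrite derive1E.
exact/df/AU.
Qed.

Lemma is_derive_coord {R : realType} {m n : nat} {X : R -> 'M[R]_(m, n)}
    {t : R} (i : 'I_m) (j : 'I_n) :
  differentiable X t -> is_derive t 1 (fun s => X s i j) (derive1 X t i j).
Proof.
move=> /derivable1_diffP dX; rewrite derive1E derive_mx // mxE.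
by apply: derivableP; move/derivable_mxP: dX; apply.
Qed.

Lemma is_derive_comp_curve {R : realType} {n : nat} {c : R -> 'rV[R]_n}
    {F : 'rV[R]_n -> R} {t : R} :
  differentiable c t -> differentiable F (c t) ->
  is_derive t 1 (F \o c)
    (\sum_(k < n) derive1 c t 0 k * 'D_(delta_mx 0 k) F (c t)).
Proof.
move=> dc dF; have dFc := differentiable_comp dc dF.
apply: DeriveDef; first exact/derivable1_diffP.
rewrite deriveE // diff_comp //= -derive1E' // {1}(row_sum_delta (derive1 c t)).
rewrite linear_sum; apply: eq_bigr => k _.
by rewrite linearZ deriveE.
Qed.

Lemma near_shift {R : realType} {P : R -> Prop} {t : R} :
  (\forall s \near t, P s) -> \forall k \near 0^', P (k + t).
Proof.
move=> Pt; apply: (@nbhs_dnbhs _ (0 : R)).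
have : (fun k : R => k + t) @ (0 : R) --> t.
  by rewrite -[X in _ --> X]add0r; apply: cvgD; [exact: cvg_id|exact: cvg_cst].
by move/(_ _ Pt).
Qed.

(** The difference quotients of [h] at [t] vanish on at least one side, since
    [I] extends beyond [t] on that side; their limit is the derivative. *)
Lemma within_derive_eq0 {R : realType} {I : set R} {h : R -> R} {t dh : R} :
  is_interval I -> (exists a b, [/\ I a, I b & a < b]) -> I t ->
  is_derive t 1 h dh -> (\forall s \near t, I s -> h s = 0) -> dh = 0.
Proof.
move=> itvI [a [b [Ia Ib ab]]] It hdh h0.
have dhE (F : set_system R) : ProperFilter F -> F `=>` 0^' ->
    (\forall k \near F, I (k + t)) -> dh = 0.
  move=> FF F0 FI.
  have hcvg : (fun k => k^-1 *: ((h \o shift t) (k *: 1) - h t)) @ F --> dh.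
    apply: cvg_trans (cvg_app _ F0) _.
    have [dh1 <-] := hdh; exact: dh1.
  have h0F : \forall k \near F, h (k + t) = 0.
    by apply: filterS2 FI (F0 _ (near_shift h0)) => k Ik; exact.
  have ht : h t = 0 by exact: (nbhs_singleton h0).
  have c0 : (fun k => k^-1 *: ((h \o shift t) (k *: 1) - h t)) @ F --> (0 : R).
    apply: cvg_near_cst.
    apply: filterS h0F => k /=; rewrite [k *: 1]mulr1 => ->.
    by rewrite ht subrr scaler0.
  exact: (cvg_unique _ hcvg c0).
have [tb|bt] := ltP t b.
- apply: (dhE 0^'+).
    by apply: within_subset => x; rewrite neq_lt => ->; rewrite orbT.
  near=> k; apply: (itvI t b) => //; apply/andP; split.
    by rewrite lerDr ltW.
  by rewrite -lerBrDr; near: k; apply: nbhs_right_le; rewrite subr_gt0.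
- have at_ := lt_le_trans ab bt.
  apply: (dhE 0^'-).
    by apply: within_subset => x; rewrite neq_lt => ->.
  near=> k; apply: (itvI a t) => //; apply/andP; split.
    by rewrite -lerBlDr; near: k; apply: nbhs_left_ge; rewrite subr_lt0.
  by rewrite gerDr ltW.
Unshelve. all: by end_near. Qed.

Lemma within_derive_unique {R : realType} {I : set R} {h1 h2 : R -> R}
    {t d1 d2 : R} :
  is_interval I -> (exists a b, [/\ I a, I b & a < b]) -> I t ->
  is_derive t 1 h1 d1 -> is_derive t 1 h2 d2 ->
  (\forall s \near t, I s -> h1 s = h2 s) -> d1 = d2.
Proof.
move=> itvI I2 It h1d h2d h12; apply/eqP; rewrite -subr_eq0; apply/eqP.
apply: (within_derive_eq0 itvI I2 It (is_deriveB h1d h2d)).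
by apply: filterS h12 => s h12s /h12s es; rewrite -[LHS]/(h1 s - h2 s) es subrr.
Qed.

(** The strict bounds place [u] in the interior of [I]; [s] and [t] themselves
    serve as bounds, since [h] takes the value [v] at neither. *)
Lemma interval_IVT {R : realType} {I : set R} {h : R -> R} {s t v : R} :
  is_interval I -> {within I, continuous h} -> I s -> I t -> h s < v < h t ->
  exists x u y, [/\ I x, I y, x < u < y & h u = v].
Proof.
move=> itvI hc Is It /andP[hsv vht].
wlog st : h v s t hc Is It hsv vht / s <= t.
  move=> wl; have [st|/ltW ts] := leP s t; first exact: (wl h v s t).
  have hNc : {within I, continuous (fun x => - h x)}.
    by move=> x; apply: cvgN; exact: hc.
  have [|||x [u [y [Ix Iy xuy /oppr_inj hu]]]] :=
      wl (fun x => - h x) (- v) t s hNc It Is; rewrite ?ltrN2 //.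
  by exists x, u, y.
have hst : {within `[s, t], continuous h}.
  apply: continuous_subspaceW hc => x /=; rewrite in_itv /= => stx.
  exact: itvI Is It _ stx.
have [|u] := @IVT R h s t v st hst.
  by rewrite ge_min (ltW hsv) /= le_max (ltW vht) orbT.
rewrite in_itv /= => /andP[su ut] huv; exists s, u, t; split => //.
rewrite !lt_neqAle su ut !andbT; apply/andP; split.
  by apply: contraTN hsv => /eqP ->; rewrite huv ltxx.
by apply: contraTN vht => /eqP <-; rewrite huv ltxx.
Qed.

(** At a common zero, the difference quotients of [b] and [s] have the same
    absolute value. *)
Lemma derive_eq0_of_norm_eq {R : realType} {b s : R -> R} {u db : R} :
  is_derive u 1 b db -> is_derive u 1 s 0 -> s u = 0 ->
  (\forall x \near u, `|b x| = `|s x|) -> db = 0.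
Proof.
move=> bd sd su bs.
have bu : b u = 0 by apply/eqP; rewrite -normr_eq0 (nbhs_singleton bs) su normr0.
have q (h : R -> R) d : is_derive u 1 h d -> h u = 0 ->
    (fun k => `|k^-1 *: h (k + u)|) @ 0^' --> `|d|.
  move=> [hd <-] hu; apply: cvg_norm; apply: cvg_trans hd.
  by apply: near_eq_cvg; near=> k; rewrite /= hu subr0 [k *: 1]mulr1.
apply/eqP; rewrite -normr_eq0; apply/eqP.
rewrite -[RHS](@normr0 R R).
apply: (cvg_unique _ (q b db bd bu)) => //.
apply: cvg_trans (q s 0 sd su); apply: near_eq_cvg.
by apply: filterS (near_shift bs) => k /= e; rewrite !normrZ e.
Unshelve. all: by end_near. Qed.

(** * Metric compatibility of the covariant derivative *)

Section RiemannianGeometry.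
Context {R : realType} {M : manifold3 R} (g : riemannian_metric M).

Definition dot (G : 'M[R]_3) (u v : 'rV[R]_3) : R := (u *m G *m v^T) 0 0.

Lemma dotDr G u v w : dot G u (v + w) = dot G u v + dot G u w.
Proof. by rewrite /dot raddfD /= mulmxDr mxE. Qed.

Lemma dotZl G a u v : dot G (a *: u) v = a * dot G u v.
Proof. by rewrite /dot -!scalemxAl mxE. Qed.

Lemma dotZr G a u v : dot G u (a *: v) = a * dot G u v.
Proof. by rewrite /dot linearZ /= -scalemxAr mxE. Qed.

Lemma dotC G u v : G^T = G -> dot G u v = dot G v u.
Proof.
move=> Gs; rewrite /dot -[in LHS](trmxK (u *m G *m v^T)) mxE.
by rewrite !trmx_mul trmxK Gs mulmxA.
Qed.

(** With the frame as the rows of [F], orthonormality says that [G *m F^T] is a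
    right inverse of [F]; being square, it is a left inverse too. *)
Lemma orthonormal_expansion {G : 'M[R]_3} {u v w : 'rV[R]_3} (x : 'rV[R]_3) :
  G^T = G ->
  [/\ dot G u u = 1, dot G v v = 1 & dot G w w = 1] ->
  [/\ dot G u v = 0, dot G u w = 0 & dot G v w = 0] ->
  x = dot G x u *: u + dot G x v *: v + dot G x w *: w.
Proof.
move=> Gs [uu vv ww] [uv uw vw].
have [vu wu wv] : [/\ dot G v u = 0, dot G w u = 0 & dot G w v = 0].
  by split; rewrite dotC.
pose F := \matrix_(k < 3) nth 0 [:: u; v; w] k.
have rowF k : row k F = nth 0 [:: u; v; w] k by rewrite rowK.
have entry (y : 'rV[R]_3) k : (y *m (G *m F^T)) 0 k =
    dot G y (nth 0 [:: u; v; w] k).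
  rewrite /dot -rowF mulmxA [LHS]mxE [RHS]mxE; apply: eq_bigr => l _.
  by congr (_ * _); rewrite !mxE.
have FGF : F *m (G *m F^T) = 1%:M.
  apply/matrixP => k l.
  have -> : (F *m (G *m F^T)) k l = (row k F *m (G *m F^T)) 0 l.
    by rewrite -row_mul [RHS]mxE.
  rewrite entry rowF mxE.
  by case: k => [[|[|[|k]]] //= ?]; case: l => [[|[|[|l]]] //= ?].
rewrite -{1}[x]mulmx1 -(mulmx1C FGF) mulmxA mulmx_sum_row.
by rewrite !big_ord_recl big_ord0 addr0 !entry !rowF /= addrA.
Qed.

Lemma gram_unitmx i x : (crd i @` mdom i) x -> gram g i x \in unitmx.
Proof.
move=> ix; rewrite -row_free_unit -kermx_eq0; apply/rowV0P => v /sub_kermxP vG.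
apply/eqP/negPn/negP => v0; have := gram_pos g ix v0.
by rewrite vG mul0mx mxE ltxx.
Qed.

Lemma derive_gram_sym i x (w : 'rV[R]_3) (a b : 'I_3) : (crd i @` mdom i) x ->
  'D_w (fun y => gram g i y a b) x = 'D_w (fun y => gram g i y b a) x.
Proof.
move=> ix; apply: near_eq_derive.
have : \forall y \near x, (crd i @` mdom i) y.
  by apply: open_nbhs_nbhs; split => //; exact: codom_open.
by apply: filterS => y /(gram_sym g) {1}<-; rewrite mxE.
Qed.

(** Lowering the upper index cancels the inverse Gram matrix: these are the
    Christoffel symbols of the first kind. *)
Lemma christoffel_first_kind i x (a b m : 'I_3) : (crd i @` mdom i) x ->
  \sum_(k < 3) christoffel g i x k a b * gram g i x k m =
  2^-1 * ('D_(delta_mx 0 a) (fun y => gram g i y m b) x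
          + 'D_(delta_mx 0 b) (fun y => gram g i y m a) x
          - 'D_(delta_mx 0 m) (fun y => gram g i y a b) x).
Proof.
move=> ix; rewrite /christoffel.
set E := fun l : 'I_3 => 'D_(delta_mx 0 a) (fun y => gram g i y l b) x
     + 'D_(delta_mx 0 b) (fun y => gram g i y l a) x
     - 'D_(delta_mx 0 l) (fun y => gram g i y a b) x.
have GV : (gram g i x)^T *m invmx (gram g i x) = 1%:M.
  by rewrite gram_sym // mulmxV // gram_unitmx.
rewrite -[RHS]/(2^-1 * E m).
under eq_bigr do rewrite -mulrA mulr_suml.
rewrite -mulr_sumr exchange_big /=; congr (_ * _).
rewrite (bigD1 m) //= [X in _ + X]big1 => [|l lm].
  rewrite addr0 -[RHS]mul1r.
  have <- : (1%:M : 'M[R]_3) m m = 1 by rewrite mxE eqxx.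
  rewrite -GV mxE mulr_suml; apply: eq_bigr => k _.
  by rewrite mxE mulrAC; congr (_ * _); rewrite mulrC.
transitivity ((1%:M : 'M[R]_3) m l * E l); last first.
  by rewrite mxE eq_sym (negbTE lm) mul0r.
rewrite -GV mxE mulr_suml; apply: eq_bigr => k _.
by rewrite mxE mulrAC; congr (_ * _); rewrite mulrC.
Qed.

(** The covariant derivative of the metric tensor vanishes: the sum of the two
    symbols of the first kind leaves one derivative of the metric. *)
Lemma christoffel_metric i x (a b m : 'I_3) : (crd i @` mdom i) x ->
  \sum_(k < 3) christoffel g i x k a b * gram g i x k m
  + \sum_(k < 3) christoffel g i x k a m * gram g i x k b
  = 'D_(delta_mx 0 a) (fun y => gram g i y b m) x.
Proof.
move=> ix; rewrite !christoffel_first_kind //.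
rewrite (derive_gram_sym _ _ _ m b) // (derive_gram_sym _ _ _ m a) //.
rewrite (derive_gram_sym _ _ _ b a) //.
set p := 'D_(_ a) _ _; set q := 'D_(_ b) _ _; set r := 'D_(_ m) _ _.
by field.
Qed.

Lemma is_derive_mulmx {n p q : nat} {A : R -> 'M[R]_(n, p)}
    {C : R -> 'M[R]_(p, q)} {dA : 'M[R]_(n, p)} {dC : 'M[R]_(p, q)} {t : R} :
  (forall i j, is_derive t 1 (fun s => A s i j) (dA i j)) ->
  (forall i j, is_derive t 1 (fun s => C s i j) (dC i j)) ->
  forall i j, is_derive t 1 (fun s => (A s *m C s) i j)
    ((dA *m C t + A t *m dC) i j).
Proof.
move=> hA hC i j.
have D k : is_derive t 1 ((fun s => A s i k) * (fun s => C s k j))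
    (A t i k *: dC k j + C t k j *: dA i k) by exact: is_deriveM.
have := is_derive_sum D.
rewrite fct_sumE => S; apply: is_derive_eq.
  rewrite (_ : (fun s => (A s *m C s) i j) =
    fun s => \sum_(k < p) A s i k * C s k j); first exact: S.
  by apply/funext => s; rewrite mxE.
rewrite !mxE -big_split /=; apply: eq_bigr => k _.
by rewrite addrC; congr (_ + _); rewrite [LHS]mulrC.
Qed.

Section AlongCurve.
Context (gamma : R -> M).

(** The connection form evaluated on the velocity, acting on row vectors from
    the right. *)
Definition connection_mx (i : cidx M) (t : R) : 'M[R]_3 :=
  \matrix_(b, k) \sum_(a < 3)
    christoffel g i (crd i (gamma t)) k a b * velocity gamma i t 0 a.

Lemma nablaE X i t :
  nabla g gamma X i t = derive1 (X i) t + X i t *m connection_mx i t.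
Proof.
rewrite /nabla; congr (_ + _); apply/rowP => k; rewrite !mxE exchange_big.
apply: eq_bigr => b _; rewrite mxE mulr_sumr; apply: eq_bigr => a _.
by rewrite mulrC.
Qed.

(** In matrix form, metric compatibility along the curve is
    G' = Omega G + (Omega G)^T, where Omega is the connection matrix. *)
Lemma is_derive_gram {i t} : mdom i (gamma t) ->
  differentiable (crd i \o gamma) t ->
  forall b m, is_derive t 1 (fun s => gram g i (crd i (gamma s)) b m)
    ((connection_mx i t *m gram g i (crd i (gamma t)) +
      (connection_mx i t *m gram g i (crd i (gamma t)))^T) b m).
Proof.
move=> it dc b m; set x := crd i (gamma t).
have ix : (crd i @` mdom i) x by exists (gamma t).
have dG : differentiable (fun y => gram g i y b m) x.
  apply: (@differentiable_comp _ _ _ _ (gram g i) (fun N : 'M[R]_3 => N b m)).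
    exact: smooth_on_differentiable (gram_smooth g i) ix.
  exact: differentiable_coord.
apply: is_derive_eq (is_derive_comp_curve dc dG) _.
under eq_bigr do rewrite -(christoffel_metric _ _ _ _ _ ix) mulrDr.
rewrite big_split /= !mxE; congr (_ + _).
  rewrite [in RHS](eq_bigr (fun k => \sum_(a < 3) christoffel g i x k a b *
    velocity gamma i t 0 a * gram g i x k m)); last first.
    by move=> k _; rewrite mxE mulr_suml.
  rewrite exchange_big /=; apply: eq_bigr => a _; rewrite mulr_sumr.
  by apply: eq_bigr => k _; rewrite mulrA; congr (_ * _); rewrite mulrC.
rewrite [in RHS](eq_bigr (fun k => \sum_(a < 3) christoffel g i x k a m *
  velocity gamma i t 0 a * gram g i x k b)); last first.
  by move=> k _; rewrite mxE mulr_suml.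
rewrite exchange_big /=; apply: eq_bigr => a _; rewrite mulr_sumr.
by apply: eq_bigr => k _; rewrite mulrA; congr (_ * _); rewrite mulrC.
Qed.

(** Differentiate the matrix product X G Y^T: the two halves of G' supply the
    connection terms of the covariant derivatives of [X] and of [Y]. *)
Lemma is_derive_inner {X Y : vfield M} {i t} : mdom i (gamma t) ->
  differentiable (crd i \o gamma) t ->
  differentiable (X i) t -> differentiable (Y i) t ->
  is_derive t 1 (inner g gamma X Y i)
    (inner g gamma (nabla g gamma X) Y i t +
     inner g gamma X (nabla g gamma Y) i t).
Proof.
move=> it dc dX dY; set G := fun s => gram g i (crd i (gamma s)).
have dYT (j : 'I_3) (k : 'I_1) : is_derive t 1 (fun s => (Y i s)^T j k)
    ((derive1 (Y i) t)^T j k).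
  rewrite (_ : (fun _ => _) = (fun s => Y i s k j)).
    by rewrite mxE; exact: is_derive_coord.
  by apply/funext => s; rewrite mxE.
have dXG := is_derive_mulmx (fun j k => is_derive_coord j k dX)
  (is_derive_gram it dc).
apply: is_derive_eq (is_derive_mulmx dXG dYT 0 0) _.
rewrite /inner !nablaE -/(G t).
have Gs : (G t)^T = G t by apply: gram_sym; exists (gamma t).
rewrite [in RHS]linearD /= !trmx_mul Gs.
rewrite !(mulmxDl, mulmxDr) !mulmxA !mxE; ring.
Qed.

End AlongCurve.
End RiemannianGeometry.

(** * Concircular fields in the Frenet frame *)

Section ConcircularAlongFrenet.
Context {R : realType} {M : manifold3 R} {g : riemannian_metric M}
  {o : orientation M} {I : set R} {gamma : R -> M} {N B V : vfield M}
  {kappa tau f : R -> R}.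
Hypotheses (I_interval : is_interval I)
  (I_nondegenerate : exists a b, [/\ I a, I b & a < b])
  (gamma_smooth : smooth_curve I gamma)
  (gamma_frame : frenet_frame g o I gamma N B kappa tau)
  (V_along : vector_field_along I gamma V)
  (V_concircular : concircular_along g I gamma V f).

Local Notation T := (velocity gamma).
Local Notation "⟨ X , Y ⟩" := (inner g gamma X Y) (X at level 9, Y at level 9).

Lemma near_mdom {i t} : I t -> mdom i (gamma t) ->
  \forall s \near t, mdom i (gamma s).
Proof.
move=> It it; apply: (gamma_smooth.1 t It).
by apply: open_nbhs_nbhs; split => //; exact: dom_open.
Qed.

Lemma curve_differentiable {i t} : I t -> mdom i (gamma t) ->
  differentiable (crd i \o gamma) t.
Proof. by move=> It it; exact: smooth_on_differentiable (gamma_smooth.2 i) _. Qed.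

Lemma velocity_differentiable {i t} : I t -> mdom i (gamma t) ->
  differentiable (T i) t.
Proof. by move=> It it; exact: smooth_on_derive1 (gamma_smooth.2 i) _. Qed.

Lemma field_differentiable {X : vfield M} {i t} : vector_field_along I gamma X ->
  I t -> mdom i (gamma t) -> differentiable (X i) t.
Proof. by move=> [Xs _] It it; exact: smooth_on_differentiable (Xs i) _. Qed.

Lemma inner_chart {X Y : vfield M} {i j t} :
  vector_field_along I gamma X -> vector_field_along I gamma Y ->
  I t -> mdom i (gamma t) -> mdom j (gamma t) -> ⟨X, Y⟩ i t = ⟨X, Y⟩ j t.
Proof.
move=> [_ Xt] [_ Yt] It it jt.
rewrite /inner (Xt i j) // (Yt i j) // (gram_transition g it jt).
by rewrite trmx_mul !mulmxA.
Qed.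

Lemma tangent_component_derive {i t} : I t -> mdom i (gamma t) ->
  is_derive t 1 (⟨V, T⟩ i) (f t + kappa t * ⟨V, N⟩ i t).
Proof.
move=> It it; have [_ _ _ [ortho _] frenet] := gamma_frame.
have [[TT _ _] _] := ortho t It i it; have [dT _ _] := frenet t It i it.
apply: is_derive_eq (is_derive_inner g gamma it (curve_differentiable It it)
  (field_differentiable V_along It it) (velocity_differentiable It it)) _.
rewrite /inner V_concircular // dT -!/(dot _ _ _) dotZl dotZr.
by rewrite [dot _ (T i t) (T i t)]TT mulr1.
Qed.

Lemma binormal_component_derive {i t} : I t -> mdom i (gamma t) ->
  is_derive t 1 (⟨V, B⟩ i) (- tau t * ⟨V, N⟩ i t).
Proof.
move=> It it; have [[_ B_along] _ _ [ortho _] frenet] := gamma_frame.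
have [_ [_ TB _]] := ortho t It i it; have [_ _ dB] := frenet t It i it.
apply: is_derive_eq (is_derive_inner g gamma it (curve_differentiable It it)
  (field_differentiable V_along It it) (field_differentiable B_along It it)) _.
rewrite /inner V_concircular // dB -!/(dot _ _ _) dotZl dotZr.
by rewrite [dot _ (T i t) (B i t)]TB mulr0 add0r.
Qed.

Lemma frenet_expansion {i t} : I t -> mdom i (gamma t) ->
  V i t = ⟨V, T⟩ i t *: T i t + ⟨V, N⟩ i t *: N i t + ⟨V, B⟩ i t *: B i t.
Proof.
move=> It it; have [_ _ _ [ortho _] _] := gamma_frame.
have [n1 n0] := ortho t It i it.
by apply: orthonormal_expansion => //; apply: gram_sym; exists (gamma t).
Qed.

Section UnitLength.
Hypothesis V_unit : along I gamma (fun i t => ⟨V, V⟩ i t = 1).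

(** This is half the derivative of the constant <V, V>. *)
Lemma potential_mul_tangent_component {i t} : I t -> mdom i (gamma t) ->
  f t * ⟨V, T⟩ i t = 0.
Proof.
move=> It it.
have dVV := is_derive_inner g gamma it (curve_differentiable It it)
  (field_differentiable V_along It it) (field_differentiable V_along It it).
have := within_derive_unique I_interval I_nondegenerate It dVV
  (is_derive_cst (1 : R) t 1).
have near1 : \forall s \near t, I s -> ⟨V, V⟩ i s = cst 1 s.
  by apply: filterS (near_mdom It it) => s si Is; exact: V_unit.
move=> /(_ near1); rewrite /inner V_concircular // -!/(dot _ _ _).
rewrite dotZl dotZr [dot _ (T i t) _]dotC; last first.
  by apply: gram_sym; exists (gamma t).
by move/eqP; rewrite -mulr2n mulrn_eq0 /= => /eqP.
Qed.

Hypothesis f_smooth : smooth_on I f.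

(** Near [t] the potential is nonzero, so the tangential component vanishes
    there, and so does its derivative. *)
Lemma potential_eq {i t} : I t -> mdom i (gamma t) -> f t != 0 ->
  f t = - kappa t * ⟨V, N⟩ i t.
Proof.
move=> It it ft; apply/eqP; rewrite mulNr -addr_eq0; apply/eqP.
apply: (within_derive_eq0 I_interval I_nondegenerate It
  (tangent_component_derive It it)).
have near_f : \forall s \near t, f s != 0.
  exact: cvgr_neq0 (smooth_on_continuous f_smooth It) ft.
apply: filterS2 (near_mdom It it) near_f.
move=> s si fs Is; have /eqP := potential_mul_tangent_component Is si.
by rewrite mulf_eq0 (negbTE fs) => /eqP.
Qed.

Hypothesis V_not_parallel : ~ parallel_along g I gamma V.
Context {theta : R -> R}.
Hypotheses (theta_smooth : smooth_on I theta)
  (theta_range : forall t, I t -> 0 <= theta t <= pi)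
  (V_angle : along I gamma (fun i t => cos (theta t) = ⟨V, N⟩ i t))
  (cos_neq0 : forall t, I t -> cos (theta t) != 0).

(** The quotient [q] below is 0 where [f] vanishes and 1 elsewhere, so by
    continuity it cannot take both values on an interval. *)
Lemma potential_neq0 {t} : I t -> f t != 0.
Proof.
have [_ [kappa_smooth _] curv_gt0 _ _] := gamma_frame.
move=> It; apply/negP => /eqP ft0; apply: V_not_parallel => t1 It1 i1 it1.
rewrite V_concircular //; have [->|ft1] := eqVneq (f t1) 0.
  by rewrite scale0r.
pose q (s : R) : R := - f s / (kappa s * cos (theta s)).
have kc s : I s -> kappa s * cos (theta s) != 0.
  by move=> Is; rewrite mulf_neq0 ?cos_neq0 // gt_eqF //; case: (curv_gt0 s Is).
have q1 s : I s -> f s != 0 -> q s = 1.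
  move=> Is fs; have [i is_] := atlas_cover (gamma s).
  rewrite /q (potential_eq Is is_ fs) -(V_angle _ Is _ is_) !mulNr opprK.
  by rewrite divff ?kc.
have qc : {within I, continuous q}.
  apply/subspace_continuousP => s Is; apply: cvg_within_filter.
  apply: cvgM; first by apply: cvgN; exact: smooth_on_continuous f_smooth Is.
  apply: cvgV; first exact: kc.
  apply: cvgM; first exact: smooth_on_continuous kappa_smooth Is.
  apply: continuous_comp; first exact: smooth_on_continuous theta_smooth Is.
  exact: continuous_cos.
have half : (0 < 2^-1 :> R) && (2^-1 < 1 :> R).
  by rewrite invr_gt0 invf_lt1 ?ltr0n ?ltr1n.
have [|x [u [y [Ix Iy xuy qu]]]] :=
    @interval_IVT _ _ q t t1 2^-1 I_interval qc It It1.
  by rewrite (q1 t1) // /q ft0 oppr0 mul0r.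
have Iu : I u.
  by case/andP: xuy => /ltW xu /ltW uy; apply: I_interval Ix Iy _ _; rewrite xu.
move: half; rewrite -qu; have [fu|fu] := eqVneq (f u) 0.
  by rewrite /q fu oppr0 mul0r ltxx.
by rewrite q1 // ltxx andbF.
Qed.

Lemma tangent_component_eq0 {i t} : I t -> mdom i (gamma t) -> ⟨V, T⟩ i t = 0.
Proof.
move=> It it; have /eqP := potential_mul_tangent_component It it.
by rewrite mulf_eq0 (negbTE (potential_neq0 It)) => /eqP.
Qed.

Lemma curvature_eq {t} : I t -> kappa t = - (1 / cos (theta t)) * f t.
Proof.
move=> It; have [i it] := atlas_cover (gamma t).
rewrite (potential_eq It it (potential_neq0 It)) -(V_angle _ It _ it).
by field; exact: cos_neq0.
Qed.

Lemma normr_binormal_component {i t} : I t -> mdom i (gamma t) ->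
  `|⟨V, B⟩ i t| = sin (theta t).
Proof.
move=> It it; have s0 := sin_ge0_pi (theta_range _ It).
have Vexp := frenet_expansion It it.
have := V_unit _ It _ it; rewrite {1}/inner {2}Vexp -/(dot _ _ _) !dotDr !dotZr.
rewrite -[dot _ _ (T i t)]/(⟨V, T⟩ i t) -[dot _ _ (N i t)]/(⟨V, N⟩ i t).
rewrite -[dot _ _ (B i t)]/(⟨V, B⟩ i t) tangent_component_eq0 //.
rewrite -(V_angle _ It _ it).
rewrite mul0r add0r -!expr2 -(cos2Dsin2 (theta t)) => /(addrI _) b2.
by apply/eqP; rewrite -(@eqrXn2 _ 2) // real_normK ?num_real // b2.
Qed.

(** The binormal component does not depend on the chart, so choosing any chart at
    each point gives one function on [I], to which the intermediate value
    theorem applies. *)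
Definition binormal_component t : R :=
  ⟨V, B⟩ (projT1 (cid (atlas_cover (gamma t)))) t.

Lemma binormal_componentE {i t} : I t -> mdom i (gamma t) ->
  binormal_component t = ⟨V, B⟩ i t.
Proof.
move=> It it; have [[_ B_along] _ _ _ _] := gamma_frame.
by rewrite /binormal_component; case: cid => j /= jt; exact: inner_chart.
Qed.

Lemma binormal_component_continuous : {within I, continuous binormal_component}.
Proof.
apply/subspace_continuousP => t It; have [i it] := atlas_cover (gamma t).
rewrite /from_subspace (binormal_componentE It it).
have bc : {for t, continuous (⟨V, B⟩ i)}.
  apply: differentiable_continuous; apply/derivable1_diffP.
  by have [] := binormal_component_derive It it.
have bcI : ⟨V, B⟩ i s @[s --> within I (nbhs t)] --> ⟨V, B⟩ i t.
  exact: cvg_within_filter bc.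
apply: (cvg_trans _ bcI); apply: near_eq_cvg.
apply: filterS (near_mdom It it) => s si Is.
by rewrite (binormal_componentE Is si).
Qed.

(** At an interior zero the binormal component would have derivative zero, as
    its absolute value sin theta has a minimum there; but its derivative is
    - tau cos theta. *)
Lemma binormal_component_interior_neq0 {x u y} : I x -> I y -> x < u < y ->
  binormal_component u != 0.
Proof.
move=> Ix Iy /andP[xu uy]; apply/negP => /eqP bu0.
have xyI s : s \in `]x, y[ -> I s.
  rewrite in_itv /= => /andP[/ltW xs /ltW sy].
  by apply: I_interval Ix Iy _ _; rewrite xs.
have uxy : u \in `]x, y[ by rewrite in_itv /= xu.
have Iu := xyI u uxy; have [i iu] := atlas_cover (gamma u).
have sd s : s \in `]x, y[ -> derivable (sin \o theta) s 1.
  move=> /xyI Is; apply/derivable1_diffP/differentiable_comp.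
    exact: smooth_on_differentiable theta_smooth Is.
  by apply/derivable1_diffP; have [] := is_derive_sin (theta s).
have su0 : sin (theta u) = 0.
  rewrite -(normr_binormal_component Iu iu) -(binormal_componentE Iu iu).
  by rewrite bu0 normr0.
have smin : is_derive u 1 (sin \o theta) 0.
  apply: (derive1_at_min (ltW (lt_trans xu uy)) sd uxy) => s /xyI Is /=.
  by rewrite su0; exact: sin_ge0_pi (theta_range _ Is).
have near_eq : \forall s \near u, `|⟨V, B⟩ i s| = `|(sin \o theta) s|.
  have near_xy : \forall s \near u, s \in `]x, y[.
    exact: near_in_itvoo.
  apply: filterS2 (near_mdom Iu iu) near_xy => s si /xyI Is.
  by rewrite /= -(normr_binormal_component Is si) normr_id.
have /eqP := derive_eq0_of_norm_eq (binormal_component_derive Iu iu)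
  smin su0 near_eq.
have [_ _ /(_ u Iu)[_ tau0] _ _] := gamma_frame.
rewrite -(V_angle _ Iu _ iu) mulf_eq0 oppr_eq0 gt_eqF //=.
by rewrite (negbTE (cos_neq0 _ Iu)).
Qed.

Lemma binormal_component_sign :
  (forall t, I t -> 0 <= binormal_component t) \/
  (forall t, I t -> binormal_component t <= 0).
Proof.
apply: contrapT => /not_orP[/existsNP[s /not_implyP[Is /negP]]].
rewrite -ltNge => bs /existsNP[t /not_implyP[It /negP]]; rewrite -ltNge => bt.
have [|x [u [y [Ix Iy xuy bu]]]] := @interval_IVT _ _ _ s t 0 I_interval
  binormal_component_continuous Is It; first by rewrite bs.
by move/eqP: (binormal_component_interior_neq0 Ix Iy xuy).
Qed.

Lemma signed_angle : exists phi : R -> R,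
  (phi = theta \/ phi = (fun t => - theta t)) /\
  along I gamma (fun i t => ⟨V, B⟩ i t = sin (phi t)).
Proof.
case: binormal_component_sign => b_sign.
  exists theta; split; first by left.
  move=> t It i it; rewrite -(normr_binormal_component It it) ger0_norm //.
  by rewrite -(binormal_componentE It it) b_sign.
exists (fun t => - theta t); split; first by right.
move=> t It i it; rewrite sinN -(normr_binormal_component It it) ler0_norm.
  by rewrite opprK.
by rewrite -(binormal_componentE It it) b_sign.
Qed.

(** Compare the two expressions - tau cos phi and phi' cos phi of the derivative
    of the binormal component sin phi. *)
Lemma torsion_eq {phi : R -> R} {t} :
  phi = theta \/ phi = (fun t => - theta t) ->
  along I gamma (fun i t => ⟨V, B⟩ i t = sin (phi t)) ->
  I t -> tau t = - derive1 phi t.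
Proof.
move=> phiE b_sin It; have [i it] := atlas_cover (gamma t).
have dtheta : derivable theta t 1.
  exact/derivable1_diffP/(smooth_on_differentiable theta_smooth).
have [dphi cphi] : derivable phi t 1 /\ cos (phi t) = cos (theta t).
  by case: phiE => ->; rewrite ?cosN; split => //; exact: derivableN.
have dsin := is_derive1_comp (is_derive_sin (phi t)) (derivableP dphi).
have := within_derive_unique I_interval I_nondegenerate It
  (binormal_component_derive It it) dsin.
have near_sin : \forall s \near t, I s -> ⟨V, B⟩ i s = (sin \o phi) s.
  by apply: filterS (near_mdom It it) => s si Is; exact: b_sin.
move=> /(_ near_sin); rewrite -(V_angle _ It _ it) cphi derive1E mulrC.
by move/(mulfI (cos_neq0 _ It)) => <-; rewrite opprK.
Qed.

Lemma frenet_form_of_prescribed_angle : exists phi : R -> R,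
  [/\ phi = theta \/ phi = (fun t => - theta t),
      along I gamma (fun i t =>
        V i t = cos (phi t) *: N i t + sin (phi t) *: B i t),
      forall t, I t -> kappa t = - (1 / cos (phi t)) * f t
    & forall t, I t -> tau t = - derive1 phi t].
Proof.
have [phi [phiE b_sin]] := signed_angle.
have cphi t : cos (phi t) = cos (theta t) by case: phiE => ->; rewrite ?cosN.
exists phi; split => // [t It i it|t It|t It].
- rewrite {1}(frenet_expansion It it) tangent_component_eq0 // scale0r add0r.
  by rewrite -(V_angle _ It _ it) b_sin // cphi.
- by rewrite cphi; exact: curvature_eq.
- exact: torsion_eq.
Qed.

End UnitLength.
End ConcircularAlongFrenet.

(** * The characterization *)

Theorem corollary3p9 (R : realType) (M : manifold3 R)
    (g : riemannian_metric M) (o : orientation M)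
    (I : set R) (gamma : R -> M) (N B V : vfield M)
    (kappa tau f theta : R -> R)
    (M_connected : connected [set: M])
    (I_interval : is_interval I)
    (I_nondegenerate : exists a b, [/\ I a, I b & a < b])
    (gamma_frenet : frenet_curve g I gamma)
    (gamma_arc_length : arc_length g I gamma)
    (gamma_frame : frenet_frame g o I gamma N B kappa tau)
    (V_along : vector_field_along I gamma V)
    (f_smooth : smooth_on I f)
    (V_concircular : concircular_along g I gamma V f)
    (V_not_parallel : ~ parallel_along g I gamma V)
    (theta_smooth : smooth_on I theta)
    (theta_range : forall t, I t -> 0 <= theta t <= pi) :
  (PA_curve g I gamma N V theta /\ (forall t, I t -> cos (theta t) != 0))
  <->
  (* theta, with values in [0, pi], determines the component of V along B only
     up to sign; phi is the corresponding signed angle *)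
  exists phi : R -> R,
    [/\ phi = theta \/ phi = (fun t => - theta t),
        along I gamma (fun i t =>
          V i t = cos (phi t) *: N i t + sin (phi t) *: B i t),
        forall t, I t -> kappa t = - (1 / cos (phi t)) * f t
      & forall t, I t -> tau t = - derive1 phi t].
Proof.
have gamma_smooth := gamma_frenet.1.
split=> [[PA cos_neq0]|[phi [phiE V_eq kappa_eq _]]].
  have V_unit : along I gamma (fun i t => inner g gamma V V i t = 1).
    by move=> t It i it; case: (PA t It i it).
  have V_angle : along I gamma (fun i t => cos (theta t) = inner g gamma V N i t).
    by move=> t It i it; case: (PA t It i it).
  exact: (frenet_form_of_prescribed_angle I_interval I_nondegenerate
    gamma_smooth gamma_frame V_along V_concircular V_unit f_smooth
    V_not_parallel theta_smooth theta_range V_angle cos_neq0).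
have cphi t : cos (phi t) = cos (theta t) by case: phiE => ->; rewrite ?cosN.
have [_ _ curv_gt0 [ortho _] _] := gamma_frame.
split=> [t It i it|t It]; last first.
  (* division by zero gives zero, so a zero of cos phi is a zero of kappa *)
  rewrite -cphi; apply/negP => /eqP c0.
  have [] := curv_gt0 t It.
  by rewrite kappa_eq // c0 invr0 mulr0 oppr0 mul0r ltxx.
have [[_ NN BB] [_ _ NB]] := ortho t It i it.
have G_sym : (gram g i (crd i (gamma t)))^T = gram g i (crd i (gamma t)).
  by apply: gram_sym; exists (gamma t).
have VN : inner g gamma V N i t = cos (theta t).
  rewrite /inner -/(dot _ _ _) dotC // V_eq // dotDr !dotZr.
  by rewrite [dot _ _ _]NN [dot _ _ (B i t)]NB mulr1 mulr0 addr0 cphi.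
have VB : inner g gamma V B i t = sin (phi t).
  rewrite /inner -/(dot _ _ _) dotC // V_eq // dotDr !dotZr.
  rewrite [dot _ (B i t) (N i t)]dotC // [dot _ (N i t) _]NB [dot _ _ _]BB.
  by rewrite mulr1 mulr0 add0r.
have VV : inner g gamma V V i t = 1.
  rewrite {1}/inner {2}V_eq // -/(dot _ _ _) dotDr !dotZr.
  by rewrite [dot _ _ _]VN [dot _ _ _]VB -cphi -!expr2 cos2Dsin2.
split=> //; apply/negP => /eqP V0; move: VV.
by rewrite /inner V0 !mul0mx mxE => /eqP; rewrite eq_sym oner_eq0.
Qed.
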